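(* There is a 9-coloring of $\mathbb{N}$, i.e. a partition of $\mathbb{N}$ into $9$ disjoint sets (color classes), such that no color class contains all three entries $x,y,z$ of a non-trivial solution $(x,y,z)\in\mathbb{N}^3$ of Markov's equation $x^2+y^2+z^2=3xyz$; that is, whenever $x,y,z\in\mathbb{N}$ satisfy $x^2+y^2+z^2=3xyz$ and $(x,y,z)\neq(1,1,1)$, the numbers $x,y,z$ do not all belong to the same color class.
   Context: $\mathbb{N}$ denotes the set of positive integers. A solution of Markov's equation $x^2+y^2+z^2=3xyz$ in positive integers is called non-trivial if it is different from $(1,1,1)$. A solution is homochromatic (for a given coloring) if $x$, $y$, $z$ all lie in the same color class; $x,y,z$ are not required to be distinct. *)

(* Defs.v *)
From mathcomp Require Import all_boot.
From mathcomp Require Import boolp classical_sets.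

Set Implicit Arguments.
Unset Strict Implicit.
Unset Printing Implicit Defensive.

Definition posint : set nat := [set n | 0 < n]%classic.

Definition markov_solution (x y z : nat) : Prop :=
  [/\ posint x, posint y, posint z & x ^ 2 + y ^ 2 + z ^ 2 = 3 * x * y * z].

(* The qualified name avoids finset's [partition]. The parts are pairwise
   disjoint, nonempty, and have union [posint]; [C i] is the i-th color class. *)
Definition coloring (k : nat) (C : 'I_k -> set nat) : Prop :=
  classical_sets.partition [set: 'I_k]%classic C posint.

Definition homochromatic (k : nat) (C : 'I_k -> set nat) (x y z : nat) : Prop :=
  exists i : 'I_k, [/\ C i x, C i y & C i z].

(* Main.v *)
(** If x, y, z all have the residue r modulo 5 then 3r^2 = 3r^3, hence r is 0
    or 1. Residue 0 is impossible because Markov triples have no common divisor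
    (Vieta descent). For residue 1 write x = 1+a, y = 1+b, z = 1+c; the
    equation becomes
      a + b + c + 3(ab + bc + ca) + 3abc = a^2 + b^2 + c^2,
    whose only terms of lowest 5-adic order lie in a + b + c. If the last nonzero
    base 5 digits of a, b, c all equal d, this forces d, 2d or 3d to vanish
    modulo 5, which is absurd. So the residues 0, 2, 3, 4, the four possible
    digits d for residue 1, and the singleton {1} are the nine colors. *)
Require Import Defs.
From mathcomp Require Import all_boot.
From mathcomp Require Import boolp classical_sets.
From mathcomp Require Import zify ring.

(** As a quadratic in [z] the equation has the second root [3 * x * y - z]; the bounds make it
    positive and smaller than [z]. *)
Lemma vieta_jump_bounds (x y z : nat) : 1 < x -> x <= y -> y <= z ->
  x ^ 2 + y ^ 2 + z ^ 2 = 3 * x * y * z -> z < 3 * x * y < 2 * z.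
Proof.
move=> x1 xy yz eq; apply/andP; split.
  rewrite ltnNge; apply/negP => le.
  have : 3 * x * y * z <= z * z by rewrite leq_mul2r le orbT.
  by nia.
(* Otherwise [t ^ 2 - 3 * x * y * t + x ^ 2 + y ^ 2] decreases from [t = y] to its zero [t = z], yet
   at [t = y] it is at most [3 * y ^ 2 - 6 * y ^ 2 < 0]. *)
rewrite ltnNge; apply/negP => le.
have [d zE] : exists d, z = y + d by exists (z - y); lia.
have : d * (2 * z) <= d * (3 * x * y) by rewrite leq_mul2l le orbT.
have : 2 * (y * y) <= x * (y * y) by rewrite leq_mul2r x1 orbT.
have : x * x <= y * y by rewrite leq_mul.
have : 0 < y * y by rewrite muln_gt0; lia.
by move: eq; rewrite zE; nia.
Qed.

(** A common divisor above 1 keeps every entry above 1 and survives each Vieta jump, so the descent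
    on the sum would never end. *)
Lemma markov_common_divisor (k x y z : nat) :
  0 < x -> 0 < y -> 0 < z -> x ^ 2 + y ^ 2 + z ^ 2 = 3 * x * y * z ->
  k %| x -> k %| y -> k %| z -> k <= 1.
Proof.
move=> x0 y0 z0 eq kx ky kz; rewrite leqNgt; apply/negP => k1.
have [n] := ubnP (x + y + z).
elim: n => // n IH in x y z x0 y0 z0 eq kx ky kz *; rewrite ltnS => le_n.
have sorted u v w : 0 < u -> u <= v -> v <= w -> u + v + w <= n ->
    u ^ 2 + v ^ 2 + w ^ 2 = 3 * u * v * w ->
    k %| u -> k %| v -> k %| w -> False.
  move=> u0 uv vw len e ku kv kw.
  have u1 : 1 < u by apply: leq_trans k1 (dvdn_leq _ _).
  have /andP[lo hi] := vieta_jump_bounds u v w u1 uv vw e.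
  have [t tE] : exists t, 3 * u * v = w + t.
    by exists (3 * u * v - w); rewrite subnKC // ltnW.
  have kt : k %| t by rewrite -(dvdn_addr _ kw) -tE dvdn_mull.
  rewrite tE in e lo hi.
  (* Product of the two roots. *)
  have twE : t * w = u ^ 2 + v ^ 2.
    by apply: (@addIn (w ^ 2)); rewrite e; ring.
  have t0 : 0 < t by clear -lo; lia.
  have {}len : u + v + t < n by clear -hi len; lia.
  apply: (IH u v t) => //; first exact: leq_trans uv.
  by rewrite tE mulnDl (mulnC w) twE; ring.
case: (leqP x y) => [xy|/ltnW xy]; case: (leqP y z) => [yz|/ltnW yz];
  case: (leqP x z) => [xz|/ltnW xz];
  [apply: (sorted x y z) | apply: (sorted x y z) | apply: (sorted x z y)
  | apply: (sorted z x y) | apply: (sorted y x z) | apply: (sorted y z x)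
  | apply: (sorted z y x) | apply: (sorted z y x)] => //;
  clear -xy yz xz le_n eq; lia.
Qed.

(** For prime [p] and positive [m], this is the lowest nonzero digit in base [p]. *)
Definition last_digit (p m : nat) : nat := (m %/ p ^ logn p m) %% p.

Lemma last_digit_gt0 (p m : nat) : prime p -> 0 < m -> 0 < last_digit p m.
Proof.
move=> p_pr m0; rewrite lt0n -/(_ %| _).
have {1}-> : p = p ^ 1 by rewrite expn1.
rewrite dvdn_divRL ?pfactor_dvdnn // -expnD add1n.
by rewrite pfactor_dvdn // ltnn.
Qed.

Lemma digit_le_logn (p m v : nat) : 0 < p -> v <= logn p m ->
  (m %/ p ^ v) %% p = if v == logn p m then last_digit p m else 0.
Proof.
move=> p0; rewrite leq_eqVlt; case: eqP => [-> // | _ /= lt].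
apply/eqP; rewrite -/(_ %| _).
have dv : p ^ v.+1 %| m by apply: dvdn_trans (pfactor_dvdnn p m); apply: dvdn_exp2l.
rewrite dvdn_divRL; first by rewrite -expnS.
by apply: dvdn_trans dv; apply: dvdn_exp2l.
Qed.

(** Residue 1 moves to the colors 5 to 8, which frees color 1 for the number 1. *)
Definition markov_color (n : nat) : nat :=
  if n <= 1 then 1 else if n %% 5 != 1 then n %% 5 else 4 + last_digit 5 n.-1.

Lemma markov_color_lt9 (n : nat) : markov_color n < 9.
Proof.
rewrite /markov_color /last_digit; case: ifP => // _; case: ifP => _.
  by apply: leq_trans (ltn_pmod n (isT : 0 < 5)) _.
by rewrite (ltn_add2l 4 _ 5) ltn_mod.
Qed.

Lemma last_digits_differ (a b c : nat) :
  0 < a -> 0 < b -> 0 < c -> 5 %| a -> 5 %| b -> 5 %| c ->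
  a + b + c + 3 * (a * b + b * c + c * a) + 3 * (a * b * c) =
    a ^ 2 + b ^ 2 + c ^ 2 ->
  last_digit 5 a = last_digit 5 b -> last_digit 5 b = last_digit 5 c -> False.
Proof.
move=> a0 b0 c0 a5 b5 c5.
(* The equation is invariant under cyclic shifts, so [a] may have the least valuation. *)
wlog [vb vc] : a b c a0 b0 c0 a5 b5 c5 /
    logn 5 a <= logn 5 b /\ logn 5 a <= logn 5 c.
  move=> H eq ab bc.
  have [vmin|[vmin|vmin]] :
      (logn 5 a <= logn 5 b /\ logn 5 a <= logn 5 c) \/
      (logn 5 b <= logn 5 c /\ logn 5 b <= logn 5 a) \/
      (logn 5 c <= logn 5 a /\ logn 5 c <= logn 5 b) by clear; lia.
  - exact: (H a b c).
  - apply: (H b c a) => //; last by rewrite -bc -ab.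
    by clear -eq; lia.
  - apply: (H c a b) => //.
    by clear -eq; lia.
  by rewrite ab bc.
set v := logn 5 a in vb vc * => eq ab bc.
have pv m : 0 < m -> v <= logn 5 m -> 5 ^ v %| m.
  by move=> m0 le; rewrite pfactor_dvdn.
have [a' aE] := dvdnP (pv a a0 (leqnn _)).
have [b' bE] := dvdnP (pv b b0 vb).
have [c' cE] := dvdnP (pv c c0 vc).
have q0 : 0 < 5 ^ v by rewrite expn_gt0.
have da := digit_le_logn 5 a v isT (leqnn _).
have db := digit_le_logn 5 b v isT vb.
have dc := digit_le_logn 5 c v isT vc.
rewrite eqxx [in LHS]aE mulnK // in da.
rewrite [in LHS]bE mulnK // in db.
rewrite [in LHS]cE mulnK // in dc.
have := last_digit_gt0 5 a isT a0.
rewrite -bc -ab in dc; rewrite -ab in db.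
have [a2 aE2] := dvdnP a5; have [b2 bE2] := dvdnP b5; have [c2 cE2] := dvdnP c5.
(* After division by [5 ^ v], each nonlinear term keeps a factor 5 from one of its other factors. *)
have red : a' + b' + c' + 5 * (3 * (a' * b2 + b' * c2 + c' * a2) + 3 * (a' * b2 * c))
    = 5 * (a' * a2 + b' * b2 + c' * c2).
  apply/eqP; rewrite -(eqn_pmul2r q0); apply/eqP.
  transitivity (a + b + c + 3 * (a * b + b * c + c * a) + 3 * (a * b * c)).
    have -> : a * b = a' * 5 ^ v * (b2 * 5) by rewrite -aE -bE2.
    have -> : b * c = b' * 5 ^ v * (c2 * 5) by rewrite -bE -cE2.
    have -> : c * a = c' * 5 ^ v * (a2 * 5) by rewrite -cE -aE2.
    by rewrite {1}aE {1}bE {2}cE; ring.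
  rewrite eq -!mulnn {1}aE aE2 {1}bE bE2 {2}cE cE2; ring.
(* Modulo 5, [a'] is the common digit, while [b'] and [c'] are each that digit or 0. *)
by move: da db dc; case: ifP => _; case: ifP => _; lia.
Qed.

Lemma markov_color_triple (x y z : nat) : markov_solution x y z ->
  markov_color x = markov_color y -> markov_color y = markov_color z ->
  (x, y, z) = (1, 1, 1).
Proof.
move=> [/= x0 y0 z0 eq].
have gt4 n : 1 < n -> 4 < 4 + last_digit 5 n.-1.
  by move=> n1; rewrite -{1}[4]addn0 ltn_add2l last_digit_gt0 // -ltnS prednK // ltnW.
(* The three kinds of numbers use disjoint sets of colors, so equal colors force the same kind. *)
have spec n : 0 < n ->
    [\/ n = 1 /\ markov_color n = 1,
       [/\ markov_color n = n %% 5, markov_color n < 5 & markov_color n != 1] |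
       [/\ 1 < n, n %% 5 = 1, markov_color n = 4 + last_digit 5 n.-1
         & 4 < markov_color n]].
  move=> n0; rewrite /markov_color; case: (leqP n 1) => [n1|n1].
    by constructor 1; split=> //; apply/eqP; rewrite eqn_leq n1.
  case: (eqVneq (n %% 5) 1) => n5 /=; first by constructor 3; split=> //; apply: gt4.
  by constructor 2; split=> //; rewrite ltn_mod.
move=> xy yz.
move: (spec x x0) (spec y y0) (spec z z0); rewrite -yz -xy.
case=> [[x1 xc]|[xc xlt xn]|[x1 x5 xc xgt]]; rewrite ?xc.
- case=> [[y1 _]|[_ _ /eqP//]|[_ _ _ //]].
  by case=> [[z1 _]|[_ _ /eqP//]|[_ _ _ //]]; rewrite x1 y1 z1.
- rewrite -xc; case=> [[_ yc]|[yc _ _]|[_ _ _ ygt]].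
  + by rewrite yc in xn.
  + case=> [[_ zc]|[zc _ _]|[_ _ _ zgt]].
    * by rewrite zc in xn.
    * have eq5 : (x ^ 2 + y ^ 2 + z ^ 2) %% 5 = (3 * x * y * z) %% 5 by rewrite eq.
      have : markov_color x = 0.
        move: eq5 xn xlt; rewrite -modnDm -(modnDm (x ^ 2)) -(modnXm 2 5 x) -(modnXm 2 5 y)
          -(modnXm 2 5 z).
        rewrite -(modnMm (3 * x * y)) -(modnMm (3 * x)) -(modnMm 3) -yc -zc -xc.
        by case: (markov_color x) => [|[|[|[|[|]]]]].
      move=> x5.
      have := @markov_common_divisor 5 x y z x0 y0 z0 eq.
      by rewrite /dvdn -xc -yc -zc x5 => /(_ isT isT isT).
    * by clear -xlt zgt; lia.
  + by clear -xlt ygt; lia.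
- rewrite -xc; case=> [[_ yc]|[_ ylt _]|[y1 y5 yc _]].
  + by rewrite yc in xgt.
  + by clear -xgt ylt; lia.
  + case=> [[_ zc]|[_ zlt _]|[z1 z5 zc _]].
    * by rewrite zc in xgt.
    * by clear -xgt zlt; lia.
    * have dvd n : 0 < n -> n %% 5 = 1 -> 5 %| n.-1.
        by clear; lia.
      exfalso; apply: (@last_digits_differ x.-1 y.-1 z.-1); rewrite ?ltn_predRL ?dvd //.
      - rewrite -{}(prednK x0) -{}(prednK y0) -{}(prednK z0) /= in eq.
        by clear -eq; lia.
      - by apply: (@addnI 4); rewrite -xc -yc.
      - by apply: (@addnI 4); rewrite -zc -yc.
Qed.

Theorem theorem2p2 :
  exists C : 'I_9 -> set nat,
    coloring C /\
    forall x y z : nat,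
      markov_solution x y z -> (x, y, z) <> (1, 1, 1) -> ~ homochromatic C x y z.
Proof.
exists (fun i n => 0 < n /\ markov_color n = i); split; last first.
  move=> x y z sol nt [i [[_ xi] [_ yi] [_ zi]]].
  by apply: nt; apply: markov_color_triple; rewrite // ?xi ?yi ?zi.
split.
- apply/seteqP; split=> [n [i _ []] //|n n0].
  by exists (Ordinal (markov_color_lt9 n)).
- move=> i j _ _ [n [[_ ni] [_ nj]]].
  by apply: val_inj; rewrite /= -ni -nj.
(* No class is empty: the entry at index [i] has color [i], and the last four are [1 + 5 * d] for
   the digits [d] from 1 to 4. *)
- move=> [i lti] _; exists (nth 0 [:: 5; 1; 2; 3; 4; 6; 11; 16; 21] i) => /=.
  by move: lti; do 9 (case: i => [|i]; first by split; vm_compute).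
Qed.
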